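(* Let $n,d\ge1$. For every $\phi\in S^d\mathbb C^n$, $$R(\phi)\le\binom{n+d-1}{d}-n+1.$$
   Context: $S^d\mathbb C^n$ denotes the space of complex homogeneous polynomials of degree $d$ in $n$ variables. The rank $R(\phi)$ of $\phi\in S^d\mathbb C^n$ is the smallest $r$ such that $\phi=\ell_1^d+\cdots+\ell_r^d$ for linear forms $\ell_j\in\mathbb C^n$. *)

(* Defs.v *)
From mathcomp Require Import all_boot all_order all_algebra.
From mathcomp Require Import reals complex mpoly.
Set Implicit Arguments.
Unset Strict Implicit.
Unset Printing Implicit Defensive.
Import GRing.Theory.
Local Open Scope ring_scope.

(* The linear form a_0 X_0 + ... + a_(n-1) X_(n-1) with coefficient vector a. *)
Definition linform (K : comNzRingType) (n : nat) (a : 'rV[K]_n) : {mpoly K[n]} :=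
  \sum_(i < n) a 0 i *: 'X_i.

Definition sum_of_powers (K : comNzRingType) (n d : nat)
    (phi : {mpoly K[n]}) (r : nat) : Prop :=
  exists l : 'I_r -> 'rV[K]_n, phi = \sum_(j < r) linform (l j) ^+ d.

(* The rank is a relation, so that "R(phi) = r" carries the existence of a
   decomposition of length r; no junk value is assigned to a form that would
   have no decomposition at all. *)
Definition is_rank (K : comNzRingType) (n d : nat)
    (phi : {mpoly K[n]}) (r : nat) : Prop :=
  sum_of_powers d phi r /\ forall s, sum_of_powers d phi s -> (r <= s)%N.

(* Main.v *)
Require Import Defs.
From HB Require Import structures.
From mathcomp Require Import all_boot all_order all_algebra.
From mathcomp Require Import boolp reals complex mpoly.
Set Implicit Arguments.
Unset Strict Implicit.
Unset Printing Implicit Defensive.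
Import Order.TTheory GRing.Theory Num.Theory.
Local Open Scope ring_scope.

(* Choose coordinates u, x_1, ..., x_p (p = n - 1) such that phi does not annihilate u^d
   under apolarity. In each pencil <u, x_i> there is then a product f_i of d distinct linear
   forms x_i - a u that is apolar to phi. The powers l^d, for l in the part of a grid indexed by
   the monomials of degree d, are dual in a triangular way to a Newton interpolation basis, so
   they form a basis of the space of forms, and the coordinate of phi at the node of the pure
   power x_i^d is proportional to its pairing with the Newton form f_i, that is 0. Hence p of
   the 'C(p + d, d) powers are not needed. *)

(** * Coefficients of powers of linear forms *)

Lemma mcoeffMXU (K : comNzRingType) (n : nat) (f : {mpoly K[n]}) (i : 'I_n) (m : 'X_{1..n}) :
  (f * 'X_i)@_m = if m i == 0%N then 0 else f@_(m - U_(i)).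
Proof.
have [mi0|mi_neq0] := eqVneq (m i) 0%N.
  apply/eqP; rewrite mcoeff_eq0 (perm_mem (msuppMX _ _)).
  apply/mapP => -[m' _ def_m]; move: mi0.
  by rewrite def_m mnmDE mnm1E eqxx.
have Um : (U_(i) <= m)%MM by rewrite lep1mP.
by rewrite -[in LHS](submK Um) addmC mcoeffMX.
Qed.

Definition mfact (n : nat) (m : 'X_{1..n}) : nat := (\prod_(i < n) (m i)`!)%N.

Lemma mfact_gt0 (n : nat) (m : 'X_{1..n}) : (0 < mfact m)%N.
Proof. by apply: prodn_gt0 => i; apply: fact_gt0. Qed.

Lemma mfactS (n : nat) (i : 'I_n) (m : 'X_{1..n}) :
  mfact (m + U_(i)) = ((m i).+1 * mfact m)%N.
Proof.
rewrite /mfact (bigD1 i) //= [in RHS](bigD1 i) //= mulnA.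
rewrite mnmDE mnm1E eqxx addn1 factS; congr (_ * _)%N.
by apply: eq_bigr => j ne_ji; rewrite mnmDE mnm1E eq_sym (negbTE ne_ji) addn0.
Qed.

Lemma expr_multinomS (K : comNzRingType) (n : nat) (v : 'I_n -> K) (i : 'I_n) (m : 'X_{1..n}) :
  \prod_(j < n) v j ^+ (m + U_(i))%MM j = v i * \prod_(j < n) v j ^+ m j.
Proof.
rewrite (bigD1 i) //= [in RHS](bigD1 i) //= mulrA -exprS.
rewrite mnmDE mnm1E eqxx addn1; congr (_ * _).
by apply: eq_bigr => j ne_ji; rewrite mnmDE mnm1E eq_sym (negbTE ne_ji) addn0.
Qed.

Lemma mcoeff_linformXn (K : comNzRingType) (n d : nat) (a : 'rV[K]_n) (m : 'X_{1..n}) :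
  mdeg m = d ->
  (linform a ^+ d)@_m * (mfact m)%:R = d`!%:R * \prod_(i < n) a 0 i ^+ m i.
Proof.
elim: d m => [|d IHd] m.
  move/eqP; rewrite mdeg_eq0 => /eqP ->.
  rewrite expr0 mcoeff1 eqxx mul1r fact0 mul1r /mfact !big1 // => i _; by rewrite mnm0E.
move=> deg_m; rewrite exprSr mulr_sumr raddf_sum mulr_suml /=.
(* Writing [d.+1] as the sum of the exponents splits the right side along the variable contributed
   by the last factor. *)
have -> : d.+1`!%:R * \prod_(i < n) a 0 i ^+ m i =
          \sum_(i < n) (m i)%:R * (d`!%:R * \prod_(j < n) a 0 j ^+ m j).
  by rewrite -mulr_suml -natr_sum -mdegE deg_m factS natrM mulrA.
apply: eq_bigr => i _; rewrite -scalerAr mcoeffZ mcoeffMXU.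
have [->|mi_neq0] := eqVneq (m i) 0%N; first by rewrite mulr0 !mul0r.
have Um : (U_(i) <= m)%MM by rewrite lep1mP.
move: deg_m; rewrite -(submK Um).
move: (m - U_(i))%MM => m'; rewrite addmK mdegD mdeg1 addn1 => -[deg_m'].
rewrite mfactS expr_multinomS mnmDE mnm1E eqxx addn1 natrM.
by rewrite mulrACA IHd // -mulrA mulrCA; congr (_ * _); rewrite mulrCA.
Qed.

Lemma linform_homog (K : comNzRingType) (n : nat) (a : 'rV[K]_n) :
  linform a \is 1.-homog.
Proof. by apply: rpred_sum => i _; rewrite rpredZ // dhomogX /= mdeg1. Qed.

Lemma linformXn_homog (K : comNzRingType) (n d : nat) (a : 'rV[K]_n) :
  linform a ^+ d \is d.-homog.
Proof. by have := dhomogMn d (linform_homog a); rewrite mul1n. Qed.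

Lemma meval_linform (K : comNzRingType) (n : nat) (a : 'rV[K]_n) (v : 'I_n -> K) :
  (linform a).@[v] = \sum_(i < n) a 0 i * v i.
Proof. by rewrite raddf_sum; apply: eq_bigr => i _ /=; rewrite mevalZ mevalXU. Qed.

(** * The apolarity pairing *)

Section Apolarity.

Variables (K : comNzRingType) (n d : nat).
Implicit Types f g : {mpoly K[n]}.

(** On forms of degree [d] this is the action of [f], read as a differential operator, on [g]. Terms
    of lower degree vanish there; the range is a finite type containing all monomials of degree
    [d]. *)
Definition apolar f g : K :=
  \sum_(m : 'X_{1..n < d.+1}) f@_m * g@_m * (mfact m)%:R.

Lemma apolarC f g : apolar f g = apolar g f.
Proof. by apply: eq_bigr => m _; rewrite (mulrC f@_m). Qed.

Fact apolar_linear f : scalar (apolar f).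
Proof.
move=> c g h; rewrite mulr_sumr -big_split /=; apply: eq_bigr => m _.
by rewrite mcoeffD mcoeffZ mulrDr mulrDl mulrCA !mulrA.
Qed.

HB.instance Definition _ f := GRing.isLinear.Build K {mpoly K[n]} K _ (apolar f) (apolar_linear f).

Lemma apolarX f (m : 'X_{1..n}) : mdeg m = d ->
  apolar f 'X_[m] = f@_m * (mfact m)%:R.
Proof.
move=> deg_m; have lt_m : (mdeg m < d.+1)%N by rewrite deg_m.
rewrite /apolar (bigD1 (BMultinom lt_m)) //= mcoeffX eqxx mulr1 big1 ?addr0 //.
move=> m' ne_m'; rewrite mcoeffX.
have [def_m|_] := eqVneq m m'; last by rewrite mulr0 mul0r.
by case/eqP: ne_m'; apply: val_inj.
Qed.

(** The weight [mfact m] cancels the denominators of the multinomial coefficients, so that only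
    evaluation remains. *)
Lemma apolar_linformXn f (a : 'rV[K]_n) : f \is d.-homog ->
  apolar (linform a ^+ d) f = d`!%:R * f.@[a 0].
Proof.
move=> hom_f; have size_f : (msize f <= d.+1)%N.
  by rewrite msizeE big_seq; apply/bigmax_leqP_seq => m m_in _; rewrite (dhomog_mf hom_f m_in).
rewrite {2}(mpolywE size_f) raddf_sum mulr_sumr; apply: eq_bigr => m _ /=.
rewrite mevalZ mevalX -mulrA mulrCA [RHS]mulrCA.
have [deg_m|/eqP ne_m] := mdeg m =P d; first by rewrite mcoeff_linformXn.
by rewrite (dhomog_nemf_coeff hom_f ne_m) !mul0r.
Qed.

End Apolarity.

Lemma prod_homog (R : comNzRingType) (n : nat) (I : Type) (r : seq I) (P : pred I)
    (e : I -> nat) (F : I -> {mpoly R[n]}) :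
  (forall i, P i -> F i \is (e i).-homog) ->
  \prod_(i <- r | P i) F i \is (\sum_(i <- r | P i) e i).-homog.
Proof.
move=> homF; elim/big_rec2: _ => [|i k f Pi hom_f]; first exact: dhomog1.
by apply: dhomogM => //; apply: homF.
Qed.

(** Each monomial is coded by the sorted tuple of its variables, hence listed once. *)
Definition monomials (n d : nat) : seq 'X_{1..n} :=
  [seq s2m t | t : d.-tuple 'I_n <- enum (basis n d)].

(** * Newton interpolation forms and the dual basis of powers *)

Section NewtonForms.

Variables (K : numFieldType) (p d : nat) (w : 'rV[K]_p.+1) (A : 'I_p.+1 -> nat -> K).

Local Notation u := (linform w).

(** The multivariate Newton basis polynomial for the nodes [A i 0], [A i 1], ..., homogenized by
    [u]. *)
Definition newton_form (m : 'X_{1..p.+1}) : {mpoly K[p.+1]} :=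
  u ^+ m ord0 * \prod_(i | i != ord0) \prod_(j < m i) ('X_i - A i j *: u).

(* The coordinate of index 0 is adjusted so that [u] takes the value 1. *)
Definition newton_point (m : 'X_{1..p.+1}) : 'rV[K]_p.+1 :=
  \row_i if i == ord0 then 1 - \sum_(j | j != ord0) w 0 j * A j (m j) else A i (m i).

Lemma newton_form_homog (m : 'X_{1..p.+1}) : newton_form m \is (mdeg m).-homog.
Proof.
rewrite mdegE (bigD1 ord0) //=; apply: dhomogM; first exact: linformXn_homog.
apply: prod_homog => i _.
have := @prod_homog K p.+1 'I_(m i) (index_enum _) xpredT (fun=> 1%N)
  (fun j => 'X_i - A i j *: u).
rewrite sum1_card card_ord; apply=> j _.
by rewrite rpredB ?rpredZ ?linform_homog // dhomogX /= mdeg1.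
Qed.

Hypothesis w0 : w 0 ord0 = 1.

Lemma linform_newton_point (m : 'X_{1..p.+1}) : u.@[newton_point m 0] = 1.
Proof.
rewrite meval_linform (bigD1 ord0) //= w0 mul1r mxE eqxx.
rewrite [X in _ + X](eq_bigr (fun j => w 0 j * A j (m j))) ?subrK // => j.
by rewrite mxE => /negbTE ->.
Qed.

Lemma newton_formE (m m' : 'X_{1..p.+1}) :
  (newton_form m).@[newton_point m' 0] =
    \prod_(i | i != ord0) \prod_(j < m i) (A i (m' i) - A i j).
Proof.
rewrite mevalM rmorphXn /= linform_newton_point expr1n mul1r rmorph_prod.
apply: eq_bigr => i /negbTE i_neq0 /=; rewrite rmorph_prod.
apply: eq_bigr => j _ /=.
by rewrite mevalB mevalZ linform_newton_point mulr1 mevalXU mxE i_neq0.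
Qed.

(** If [m' i < m i], the factor of index [j = m' i] vanishes at the point. *)
Lemma newton_form_neq0 (m m' : 'X_{1..p.+1}) (i : 'I_p.+1) :
  (newton_form m).@[newton_point m' 0] != 0 -> i != ord0 -> (m i <= m' i)%N.
Proof.
rewrite newton_formE => nz i_neq0; rewrite leqNgt; apply: contra nz => lt_i.
by rewrite (bigD1 i) //= (bigD1 (Ordinal lt_i)) //= subrr !mul0r.
Qed.

Hypothesis A_inj : forall i, i != ord0 -> {in [pred j | (j <= d)%N] &, injective (A i)}.

Lemma newton_form_diag (m : 'X_{1..p.+1}) : (mdeg m <= d)%N ->
  (newton_form m).@[newton_point m 0] != 0.
Proof.
move=> deg_m; rewrite newton_formE.
apply/prodf_neq0 => i i_neq0; apply/prodf_neq0 => j _; rewrite subr_eq0.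
have le_i : (m i <= d)%N.
  by apply: leq_trans deg_m; rewrite mdegE (bigD1 i) //= leq_addr.
apply/eqP => /(A_inj i_neq0); rewrite !inE => /(_ le_i (leq_trans (ltnW (ltn_ord j)) le_i)) eq_j.
by have := ltn_ord j; rewrite -eq_j ltnn.
Qed.

Local Notation L m := (linform (newton_point m) ^+ d).

Lemma apolar_newton_sum (c : 'X_{1..p.+1} -> K) (m : 'X_{1..p.+1}) : mdeg m = d ->
  apolar d (newton_form m) (\sum_(m' <- monomials p.+1 d) c m' *: L m') =
    d`!%:R * \sum_(m' <- monomials p.+1 d) c m' * (newton_form m).@[newton_point m' 0].
Proof.
move=> deg_m; rewrite linear_sum mulr_sumr; apply: eq_bigr => m' _ /=.
rewrite linearZ /= apolarC apolar_linformXn 1?mulrCA //.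
by rewrite -deg_m; apply: newton_form_homog.
Qed.

(* The matrix of values is triangular for the order given by the exponent of index 0. *)
Lemma newton_powers_free (c : 'X_{1..p.+1} -> K) :
  \sum_(m <- monomials p.+1 d) c m *: L m = 0 ->
  forall m, mdeg m = d -> c m = 0.
Proof.
move=> sum0 m; have [k le_k] := ubnP (m ord0); elim: k m le_k => // k IHk m le_k deg_m.
have /eqP := apolar_newton_sum c deg_m; rewrite sum0 linear0 eq_sym mulf_eq0.
rewrite pnatr_eq0 -leqn0 leqNgt fact_gt0 /=.
rewrite (bigD1_seq m) ?uniq_basis //=; last by rewrite /monomials -basis_cover deg_m.
rewrite big_seq_cond big1 ?addr0 => [|m' /andP[]].
  by rewrite mulf_eq0 (negbTE (newton_form_diag _)) ?deg_m // orbF => /eqP.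
rewrite -basis_cover => /eqP deg_m' ne_m.
have [->|nz] := eqVneq (newton_form m).@[newton_point m' 0] 0; first by rewrite mulr0.
(* A nonzero value forces [m i <= m' i] for all [i != ord0]. As the degrees agree,
   [m' ord0 <= m ord0], with equality only if [m' = m]. *)
rewrite IHk ?mul0r //; apply: leq_trans (le_k : (m ord0 <= k)%N); rewrite ltn_neqAle.
have le_m i : i != ord0 -> (m i <= m' i)%N by apply: newton_form_neq0 nz.
have le_sum : (\sum_(i < p.+1 | i != ord0) m i <= \sum_(i < p.+1 | i != ord0) m' i)%N.
  by apply: leq_sum.
have := deg_m'; rewrite -deg_m !mdegE (bigD1 ord0) //= [in RHS](bigD1 ord0) //= => eq_deg.
have le0 : (m' ord0 <= m ord0)%N.
  by rewrite -(leq_add2r (\sum_(i < p.+1 | i != ord0) m' i)) eq_deg leq_add2l.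
rewrite le0 andbT; apply: contra ne_m => /eqP eq0.
move: eq_deg; rewrite eq0 => /addnI eq_sum.
apply/eqP/mnmP => i; have [->//|i_neq0] := eqVneq i ord0.
apply/eqP; rewrite eqn_leq le_m // andbT leqNgt; apply/negP => lt_i.
suff : (\sum_(i < p.+1 | i != ord0) m i < \sum_(i < p.+1 | i != ord0) m' i)%N.
  by rewrite eq_sum ltnn.
by rewrite (bigD1 i) //= [ltnRHS](bigD1 i) //= -addSn leq_add // leq_sum // => j /andP[/le_m].
Qed.

(** There are as many powers as monomials of degree [d], so the free family spans by dimension. *)
Lemma newton_powers_span (f : {mpoly K[p.+1]}) : f \is d.-homog ->
  exists c : 'X_{1..p.+1} -> K, f = \sum_(m <- monomials p.+1 d) c m *: L m.
Proof.
move=> hom_f; set B := monomials p.+1 d; pose N := size B.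
pose M (i : 'I_N) := nth 0%MM B i.
have sumB (G : 'X_{1..p.+1} -> {mpoly K[p.+1]}) : \sum_(m <- B) G m = \sum_(i < N) G (M i).
  by rewrite (big_nth 0%MM) big_mkord.
have uniqB : uniq B := uniq_basis _ _.
have idxK (i : 'I_N) : index (M i) B = i by rewrite index_uniq.
have homM (m : 'X_{1..p.+1}) : L m \is d.-homog := linformXn_homog _ _.
pose X := [tuple DHomog (homM (M i)) | i < N].
have valX (i : 'I_N) : val X`_i = L (M i) by rewrite (nth_mktuple _ _ i).
have freeX : free X.
  apply/freeP => k sum0 i.
  (* Coefficients indexed by position in [B] become a function of monomials, with value 0 outside
     [B]. *)
  have := @newton_powers_free (fun m => if insub (index m B) is Some j then k j else 0).
  rewrite -/B sumB (eq_bigr (fun j => val (k j *: X`_j))); last first.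
    by move=> j _; rewrite idxK valK linearZ /= valX.
  rewrite -raddf_sum sum0 => /(_ erefl (M i)); rewrite idxK valK; apply.
  by apply/eqP; rewrite basis_cover mem_nth.
have : DHomog hom_f \in <<X>>%VS.
  suff -> : <<X>>%VS = fullv by apply: memvf.
  apply/eqP; rewrite eqEdim subvf dimvf (eqP freeX) size_tuple /N size_basis.
  exact: leqnn.
move/coord_span/(congr1 val) => /= def_f.
exists (fun m => if insub (index m B) is Some j then coord X j (DHomog hom_f) else 0).
rewrite sumB [LHS]def_f raddf_sum; apply: eq_bigr => i _.
by rewrite idxK valK /= valX.
Qed.

End NewtonForms.

(** * Products of distinct linear forms killed by a functional *)

Section SquarefreeAnnihilator.

Variables (K : numClosedFieldType) (n : nat).
Implicit Types (L : {scalar {mpoly K[n]}}) (x u v : {mpoly K[n]}).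

(** In the expansion in [s], the top power takes the [u] term from every factor. The multiplier [v]
    absorbs the [x] or [u] picked at each induction step. *)
Lemma scaled_nodes_poly L x u v (e : seq K) :
  exists P : {poly K}, [/\ (size P <= (size e).+1)%N,
    P`_(size e) = \prod_(c <- e) - c * L (v * u ^+ size e)
    & forall s, L (v * \prod_(c <- e) (x - (s * c) *: u)) = P.[s]].
Proof.
elim: e v => [|c e IHe] v.
  exists (L v)%:P; rewrite size_polyC leq_b1 big_nil expr0 mulr1 mul1r coefC.
  by split=> // s; rewrite big_nil mulr1 hornerC.
have [P1 [size1 _ P1E]] := IHe (v * x); have [P2 [size2 lead2 P2E]] := IHe (v * u).
exists (P1 - c *: (P2 * 'X)); split=> [|/=|s].
- rewrite (leq_trans (size_polyD _ _)) // geq_max size_polyN (leq_trans size1) //=.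
  rewrite (leq_trans (size_scale_leq _ _)) // (leq_trans (size_polyMleq _ _)) //.
  by rewrite size_polyX addn2.
- rewrite coefB coefZ coefMX /= lead2 (nth_default _ size1) sub0r big_cons exprS.
  by rewrite !mulrA !mulNr.
rewrite big_cons hornerD hornerN hornerZ hornerMX -P1E -P2E.
rewrite mulrA mulrBr mulrBl linearB /= -scalerAr -scalerAl linearZ /=.
by congr (_ - _); rewrite [RHS]mulrA [RHS]mulrC [RHS]mulrA.
Qed.

(** The top coefficient is nonzero, so only finitely many scalings [s] are bad. Stating this through
    a polynomial lets several such conditions be combined by multiplication. *)
Lemma scaled_nodes_generic L x u v (e : seq K) : 0 \notin e -> L (v * u ^+ size e) != 0 ->
  exists2 P : {poly K}, P != 0 &
    forall s, P.[s] != 0 -> L (v * \prod_(c <- e) (x - (s * c) *: u)) != 0.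
Proof.
move=> e_neq0 nz; have [P [_ lead PE]] := scaled_nodes_poly L x u v e.
exists P => [|s]; last by rewrite PE.
apply: contraTneq isT => P0; move/eqP: lead; rewrite P0 coef0 eq_sym mulf_eq0 (negbTE nz) orbF.
rewrite prodf_seq_eq0 => /hasP[c c_e /=]; rewrite oppr_eq0 => /eqP c0.
by rewrite -c0 c_e in e_neq0.
Qed.

Lemma common_generic (T : eqType) (r : seq T) (C : T -> K -> Prop) :
  (forall c, c \in r -> exists2 P : {poly K}, P != 0 & forall s, P.[s] != 0 -> C c s) ->
  exists2 P : {poly K}, P != 0 & forall s, P.[s] != 0 -> forall c, c \in r -> C c s.
Proof.
elim: r => [|c r IHr] genC; first by exists 1; rewrite ?oner_eq0.
have [P P_neq0 PC] := genC c (mem_head _ _).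
have [|Q Q_neq0 QC] := IHr; first by move=> c' c'_r; apply: genC; rewrite inE c'_r orbT.
exists (P * Q) => [|s]; first by rewrite mulf_neq0.
rewrite hornerM mulf_eq0 negb_or => /andP[Ps Qs] c'; rewrite inE => /predU1P[->|c'_r].
  exact: PC.
exact: QC.
Qed.

Lemma fresh_element (r : seq K) : exists z, z \notin r.
Proof.
have /closed_nonrootP[z] : \prod_(a <- r) ('X - a%:P) != 0.
  by apply: monic_neq0; apply: monic_prod_XsubC.
by rewrite root_prod_XsubC; exists z.
Qed.

(* The last root is the ratio making the functional vanish; it differs from the others
   exactly when the functional does not vanish once one of them is doubled. *)
Lemma squarefree_annihilator L x u (d : nat) : (0 < d)%N -> L (u ^+ d) != 0 ->
  exists2 A : nat -> K, {in [pred j | (j <= d)%N] &, injective A} &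
    L (\prod_(j < d) (x - A j *: u)) = 0.
Proof.
case: d => // k _ nz; pose e : seq K := [seq j.+1%:R | j <- iota 0 k].
have size_e : size e = k by rewrite size_map size_iota.
have e_neq0 : 0 \notin e.
  by apply/mapP => -[j _ /esym/eqP]; rewrite pnatr_eq0.
have uniq_e : uniq e.
  rewrite map_inj_uniq ?iota_uniq // => i j /eqP.
  by rewrite eqr_nat eqSS => /eqP.
pose F s := \prod_(c <- e) (x - (s * c) *: u).
have [|Q Q_neq0 QF] := @scaled_nodes_generic L x u u e e_neq0.
  by rewrite size_e -exprS.
have [|P P_neq0 PF] := @common_generic _ e (fun c s => L ((x - (s * c) *: u) * F s) != 0).
  move=> c c_e; have [||P P_neq0 PF] := @scaled_nodes_generic L x u 1 (c :: e).
  - by rewrite inE negb_or e_neq0 andbT; apply: contraNneq e_neq0 => ->.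
  - by rewrite mul1r /= size_e.
  by exists P => // s /PF; rewrite mul1r big_cons.
(* The factor ['X] keeps the nodes [s * c] distinct, [Q] makes the denominator of [b] nonzero, and
   [P] separates [b] from these nodes. *)
have /closed_nonrootP[s] : 'X * Q * P != 0 by rewrite !mulf_neq0 ?polyX_eq0.
rewrite /root !hornerM hornerX !mulf_eq0 !negb_or => /andP[/andP[s_neq0 /QF LuF] /PF LxF].
pose b := L (x * F s) / L (u * F s).
pose r := rcons [seq s * c | c <- e] b.
have size_r : size r = k.+1 by rewrite size_rcons size_map size_e.
have uniq_r : uniq r.
  rewrite rcons_uniq (map_inj_uniq (mulfI s_neq0)) uniq_e andbT.
  apply/mapP => -[c /LxF nz_c def_b]; case/eqP: nz_c.
  by rewrite mulrBl -scalerAl linearB linearZ /= -def_b divfK ?subrr.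
(* The product uses only [d] roots, but injectivity on [0..d] asks for one more value. *)
have [t t_r] := fresh_element r.
exists (nth 0 (rcons r t)) => [i j|].
  rewrite !inE => le_i le_j /eqP; rewrite nth_uniq; last by rewrite rcons_uniq t_r.
  - by move/eqP.
  - by rewrite size_rcons size_r.
  - by rewrite size_rcons size_r.
rewrite (eq_bigr (fun j : 'I_k.+1 => x - nth 0 r j *: u)); last first.
  by move=> j _; rewrite nth_rcons size_r ltn_ord.
rewrite -(big_mkord xpredT (fun j => x - nth 0 r j *: u)) -size_r.
rewrite -(big_nth 0 xpredT (fun a => x - a *: u)) big_rcons /= big_map -/(F s).
by rewrite mulrC mulrBl -scalerAl linearB linearZ /= divfK ?subrr.
Qed.

End SquarefreeAnnihilator.

(** * Choice of [u] and removal of the pure powers *)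

Lemma homog_nonroot (K : numFieldType) (p d : nat) (f : {mpoly K[p.+1]}) :
  f \is d.-homog -> f != 0 -> exists2 w : 'rV[K]_p.+1, w 0 ord0 = 1 & f.@[w 0] != 0.
Proof.
move=> hom_f f_neq0; pose e0 : 'rV[K]_p.+1 := \row_i (i == ord0)%:R.
pose A (_ : 'I_p.+1) (j : nat) : K := j%:R.
have e00 : e0 0 ord0 = 1 by rewrite mxE.
have A_inj i : i != ord0 -> {in [pred j | (j <= d)%N] &, injective (A i)}.
  by move=> _ j k _ _ /eqP; rewrite eqr_nat => /eqP.
have pt0 m : newton_point e0 A m 0 ord0 = 1.
  by rewrite mxE eqxx big1 ?subr0 // => j /negbTE j_neq0; rewrite mxE j_neq0 mul0r.
have [|all0] := boolP (has (fun m => f.@[newton_point e0 A m 0] != 0) (monomials p.+1 d)).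
  by case/hasP => m _ nz; exists (newton_point e0 A m).
(* If [f] vanishes at all nodes, it is apolar to the powers spanning the forms, hence to every
   monomial, and its coefficients are 0. *)
case/eqP: f_neq0; apply/mpolyP => m; rewrite mcoeff0.
have [deg_m|/eqP ne_m] := mdeg m =P d; last exact: dhomog_nemf_coeff hom_f ne_m.
apply/eqP; have := apolarX f deg_m.
have [|c ->] := newton_powers_span e00 A_inj (f := 'X_[m]).
  by rewrite dhomogX /= deg_m.
rewrite linear_sum big_seq big1 => [/esym/eqP|m' m'_in].
  by rewrite mulf_eq0 pnatr_eq0 -[mfact m == 0%N]negbK -lt0n mfact_gt0 orbF.
rewrite linearZ /= apolarC apolar_linformXn //.
by have /hasPn/(_ _ m'_in) := all0; rewrite negbK => /eqP ->; rewrite !mulr0.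
Qed.

Lemma linformZ (K : comNzRingType) (n : nat) (c : K) (a : 'rV[K]_n) :
  linform (c *: a) = c *: linform a.
Proof. by rewrite scaler_sumr; apply: eq_bigr => i _; rewrite mxE scalerA. Qed.

Lemma rank_bound (K : numClosedFieldType) (p d : nat) (f : {mpoly K[p.+1]}) :
  (0 < d)%N -> f \is d.-homog ->
  exists2 r, (r <= 'C(d + p, d) - p)%N & sum_of_powers d f r.
Proof.
move=> d_gt0 hom_f; have [->|f_neq0] := eqVneq f 0.
  by exists 0%N => //; exists (fun=> 0); rewrite big_ord0.
have [w w0 fw_neq0] := homog_nonroot hom_f f_neq0.
have /fin_all_exists[A A_prop] (i : 'I_p.+1) : exists Ai : nat -> K,
    {in [pred j | (j <= d)%N] &, injective Ai} /\
    apolar d f (\prod_(j < d) ('X_i - Ai j *: linform w)) = 0.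
  have [|Ai Ai_inj Ai0] := @squarefree_annihilator K p.+1 (apolar d f) 'X_i (linform w) d d_gt0.
    (* The pairing of [f] with the power of [linform w] is [d!] times the nonzero value of [f] at
       [w]. *)
    by rewrite /= apolarC apolar_linformXn // mulf_neq0 // pnatr_eq0 -lt0n fact_gt0.
  by exists Ai.
have A_inj i : i != ord0 -> {in [pred j | (j <= d)%N] &, injective (A i)}.
  by move=> _; have [] := A_prop i.
have [c def_f] := newton_powers_span w0 A_inj hom_f.
pose pure (i : 'I_p.+1) : 'X_{1..p.+1} := (U_(i) *+ d)%MM.
have deg_pure i : mdeg (pure i) = d by rewrite mdegMn mdeg1 mul1n.
have pureE i j : pure i j = (if i == j then d else 0)%N.
  by rewrite mulmnE mnm1E; case: eqP; rewrite ?mul1n ?mul0n.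
have pure_inj : injective pure.
  move=> i j /mnmP/(_ i); rewrite !pureE eqxx; case: eqP => // _ d0.
  by rewrite d0 in d_gt0.
(* Among monomials of degree [d], only [pure i] has exponent at least [d] at [i]. So pairing its
   Newton form with [f] isolates [c (pure i)] up to a nonzero factor. *)
have c_pure i : i != ord0 -> c (pure i) = 0.
  move=> i_neq0; have [_] := A_prop i.
  have newton_pure : newton_form w A (pure i) = \prod_(j < d) ('X_i - A i j *: linform w).
    rewrite /newton_form pureE (negbTE i_neq0) expr0 mul1r (bigD1 i) //= pureE eqxx.
    rewrite [X in _ * X]big1 ?mulr1 // => j /andP[_ /negbTE j_neq_i].
    by rewrite pureE eq_sym j_neq_i big_ord0.
  rewrite -newton_pure apolarC [in X in apolar _ _ X]def_f apolar_newton_sum //.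
  move/eqP; rewrite mulf_eq0 pnatr_eq0 -leqn0 leqNgt fact_gt0 /=.
  rewrite (bigD1_seq (pure i)) ?uniq_basis //=; last by rewrite -basis_cover deg_pure.
  rewrite big_seq_cond big1 ?addr0 => [|m /andP[]].
    rewrite mulf_eq0 => /orP[/eqP //|]; apply: contraTeq => _.
    by apply: newton_form_diag w0 A_inj _ _; rewrite deg_pure.
  rewrite -basis_cover => /eqP deg_m ne_m.
  have [->|nz] := eqVneq (newton_form w A (pure i)).@[newton_point w A m 0] 0.
    by rewrite mulr0.
  have := newton_form_neq0 w0 nz i_neq0; rewrite pureE eqxx => le_d.
  case/eqP: ne_m; apply/mnmP => j; rewrite pureE.
  move: deg_m; rewrite mdegE (bigD1 i) //= => eq_d.
  have [<-|ne_ij] := eqVneq i j.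
    by apply/eqP; rewrite eqn_leq le_d andbT -eq_d leq_addr.
  move: eq_d; rewrite (bigD1 j) 1?eq_sym //= => eq_d.
  apply/eqP; rewrite -leqn0 -(leq_add2l (m i)) addn0 (leq_trans _ le_d) //.
  by rewrite -eq_d addnA leq_addr.
pose pures := [seq pure (lift ord0 i) | i : 'I_p].
pose B' := [seq m <- monomials p.+1 d | m \notin pures].
have def_f' : f = \sum_(m <- B') c m *: linform (newton_point w A m) ^+ d.
  rewrite big_filter [LHS]def_f [RHS]big_mkcond /=; apply: eq_bigr => m _.
  by case: ifP => // /negbFE/mapP[i _ ->]; rewrite c_pure ?scale0r.
have le_B' : (size B' <= 'C(d + p, d) - p)%N.
  rewrite -size_basis -/(monomials _ _) size_filter -(count_predC (mem pures)).
  have size_pures : size pures = p by rewrite size_map -cardE card_ord.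
  have uniq_pures : uniq pures.
    by rewrite map_inj_uniq ?enum_uniq // => i j /pure_inj/lift_inj.
  rewrite -[leqLHS](addKn (count (mem pures) (monomials p.+1 d))) leq_sub2l //.
  rewrite -[leqLHS]size_pures -size_filter.
  apply: uniq_leq_size => // m m_pures; rewrite mem_filter /= m_pures /=.
  by case/mapP: m_pures => i _ ->; rewrite -basis_cover deg_pure.
exists (size B') => //.
(* A [d]-th root moves each coefficient into the linear form. *)
exists (fun j => d.-root (c (nth 0%MM B' j)) *: newton_point w A (nth 0%MM B' j)).
rewrite def_f' (big_nth 0%MM) big_mkord; apply: eq_bigr => j _.
by rewrite linformZ exprZn rootCK.
Qed.

Theorem corollary1p5 (R : realType) (n d : nat) (hn : (1 <= n)%N) (hd : (1 <= d)%N)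
    (phi : {mpoly R[i][n]}) (hphi : phi \is d.-homog) :
  exists r : nat, is_rank d phi r /\ (r <= 'C(n + d - 1, d) - n + 1)%N.
Proof.
case: n hn phi hphi => // p _ phi hphi.
have [r0 le_r0 pow_r0] := rank_bound hd hphi.
have ex_r : exists r, `[< sum_of_powers d phi r >] by exists r0; apply/asboolP.
case: (ex_minnP ex_r) => r /asboolP pow_r min_r.
exists r; split; first by split=> // s pow_s; apply/min_r/asboolP.
apply: leq_trans (min_r r0 (asboolT pow_r0)) _; apply: leq_trans le_r0 _.
(* With [n = p.+1], subtracting [n] and adding 1 is at least subtracting [p], even for truncated
   subtraction. *)
by rewrite addSn subn1 (addnC d) subnS addn1 leqSpred.
Qed.
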